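(* Let $H$ be the complete $(n-2)$-uniform hypergraph on the vertex set $\{1,\dots,n\}$. Then for $-1\le r\le 1$, $$\dim HC_r(\Delta(H))=\binom{n}{r+1}.$$
   Context: All vector spaces are over a fixed field of characteristic zero. A hypergraph $H=(V,E)$ consists of a vertex set $V=\{1,\dots,n\}$ and a set $E$ of subsets of $V$ (hyperedges). It is complete $k$-uniform if its hyperedges are exactly the $k$-element subsets of $V$. For $r\ge -1$ consider ordered set partitions $(B_1,\dots,B_{r+2})$ of $\{1,\dots,n\}$ into nonempty blocks, at least one of which contains a hyperedge of $H$, modulo the signed cyclic relation $(B_1,\dots,B_{r+2})\sim(-1)^{r+1}(B_{\sigma(1)},\dots,B_{\sigma(r+2)})$, where $\sigma=(1,2,\dots,r+2)$ is the cyclic permutation. The class is written $[B_1,\dots,B_{r+2}]$ and is represented by the unique representative with $1\in B_1$. Let $C_r$ be the vector space with basis these classes $[B_1,\dots,B_{r+2}]$ with $1\in B_1$, and let $$\partial_r([B_1,\dots,B_{r+2}])=\sum_{i=1}^{r+1}(-1)^{i+1}[B_1,\dots,B_i\cup B_{i+1},\dots,B_{r+2}]+(-1)^{r+3}[B_1\cup B_{r+2},B_2,\dots,B_{r+1}]$$ for $r\ge 0$, and $\partial_{-1}=0$. The cyclic coloring complex $\Delta(H)$ is the chain complex $(C_r,\partial_r)$, and $HC_r(\Delta(H))=\ker\partial_r/\operatorname{im}\partial_{r+1}$.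
   Formalization: The formal theorem assumes n ≥ 5: the claim as stated fails for smaller n, e.g. for n = 4 the dimensions for r = −1, 0, 1 are 1, 3, 8 instead of 1, 4, 6, and for n = 3 they are 1, 2, 1 instead of 1, 3, 3. *)

(* Defs.v *)
From HB Require Import structures.
From mathcomp Require Import all_boot all_order all_algebra.
From mathcomp Require Import zify.

Set Implicit Arguments.
Unset Strict Implicit.
Unset Printing Implicit Defensive.

Import GRing.Theory.

(* A hypergraph on {1, ..., n} is its set of hyperedges, as in                *)
(* E : {set {set 'I_n}}; the vertex v of the paper is the ordinal of value    *)
(* v - 1, so the distinguished vertex 1 is the ordinal of value 0.            *)

Definition complete_uniform (n k : nat) : {set {set 'I_n}} :=
  [set e : {set 'I_n} | #|e| == k].

Section OrderedPartitions.

Variables (n : nat) (E : {set {set 'I_n}}).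

Definition ordered_partition (B : seq {set 'I_n}) : bool :=
  uniq B && partition [set A in B] [set: 'I_n].

Definition has_hyperedge (B : seq {set 'I_n}) : bool :=
  has (fun A : {set 'I_n} => [exists e in E, e \subset A]) B.

Definition contains1 (A : {set 'I_n}) : bool := [exists x in A, val x == 0].

Definition pos1 (B : seq {set 'I_n}) : nat := find contains1 B.

Definition admissible (B : seq {set 'I_n}) : bool :=
  ordered_partition B && has_hyperedge B.

(* Homological degrees are shifted by one to become natural numbers: the      *)
(* index p stands for degree r = p - 1, i.e. for partitions into              *)
(* r + 2 = p + 1 blocks.                                                      *)
Definition cyclic_partition (p : nat) :=
  {B : p.+1.-tuple {set 'I_n} | admissible B && contains1 (thead B)}.

(* B_1, ..., B_i :|: B_(i+1), ..., with i counted from 0 *)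
Definition merge (i : nat) (B : seq {set 'I_n}) : seq {set 'I_n} :=
  take i B ++ (nth set0 B i :|: nth set0 B i.+1) :: drop i.+2 B.

(* B_1 :|: B_(r+2), B_2, ..., B_(r+1) *)
Definition merge_last (B : seq {set 'I_n}) : seq {set 'I_n} :=
  (head set0 B :|: last set0 B) :: behead (take (size B).-1 B).

Lemma ordered_partitionE B : ordered_partition B =
  (set0 \notin B) && [forall x, count (fun A : {set 'I_n} => x \in A) B == 1].
Proof.
apply/andP/andP => [[uB /and3P[/eqP cB tB nB]]|[nB /forallP cB]].
  split; first by move: nB; rewrite inE.
  apply/forallP => x; rewrite eqn_leq; apply/andP; split.
    rewrite -size_filter.
    apply: (@uniq_leq_size _ _ [:: pblock [set A in B] x]).
      exact: filter_uniq.
    move=> A; rewrite mem_filter inE => /andP[xA AB].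
    by rewrite (def_pblock tB _ xA) // inE.
  rewrite -has_count; apply/hasP.
  have : x \in cover [set A in B] by rewrite cB inE.
  by case/bigcupP => A; rewrite inE => AB xA; exists A.
have uB : uniq B.
  apply: count_mem_uniq => A.
  have [AB|/count_memPn -> //] := boolP (A \in B).
  apply/eqP; rewrite eqn_leq -has_count has_pred1 AB andbT.
  have [A0|[x xA]] := set_0Vmem A; first by rewrite -A0 AB in nB.
  rewrite [nat_of_bool _]/= -[X in _ <= X](eqP (cB x)).
  by apply: sub_count => D /= /eqP ->.
split=> //; apply/and3P; split; last by rewrite inE.
  apply/eqP/setP => x; rewrite inE; apply/bigcupP.
  have : has (fun A : {set 'I_n} => x \in A) B by rewrite has_count (eqP (cB x)).
  by case/hasP => A AB xA; exists A; rewrite ?inE.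
apply/trivIsetP => A A'; rewrite !inE => AB A'B AA'.
rewrite disjoint_subset; apply/subsetP => x xA; rewrite inE.
apply/negP => xA'.
have : size [:: A; A'] <= count (fun A : {set 'I_n} => x \in A) B.
  rewrite -size_filter; apply: uniq_leq_size; first by rewrite /= inE AA'.
  by move=> D; rewrite mem_filter !inE => /orP[] /eqP ->; rewrite ?xA ?xA'.
by rewrite (eqP (cB x)).
Qed.

Lemma admissible_rot k B : admissible (rot k B) = admissible B.
Proof.
rewrite /admissible /has_hyperedge has_rot !ordered_partitionE mem_rot.
congr (_ && _ && _); apply: eq_forallb => x.
by rewrite (permP (permEl (perm_rot k B))).
Qed.

Lemma merge_rotr B : 1 < size B -> merge_last B = merge 0 (rotr 1 B).
Proof.
case: B => [|A B] //; case/lastP: B => [|B Z] // _.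
rewrite -[A :: rcons B Z]/(rcons (A :: B) Z) rotr1_rcons /merge_last /merge.
rewrite /= size_rcons ?take0 ?drop0 last_rcons setUC.
by rewrite -cats1 /= take_size_cat.
Qed.

Lemma cat_merge i (B : seq {set 'I_n}) : i.+1 < size B ->
  B = take i B ++ [:: nth set0 B i; nth set0 B i.+1] ++ drop i.+2 B.
Proof.
move=> iB; rewrite /= -drop_nth // -drop_nth; last exact: ltnW.
by rewrite cat_take_drop.
Qed.

Lemma admissible_merge i B :
  i.+1 < size B -> admissible B -> admissible (merge i B).
Proof.
move=> iB; rewrite {1}(cat_merge iB) /merge /admissible !ordered_partitionE.
move: (take i B) (nth _ B i) (nth _ B i.+1) (drop _ _) => s A A' t.
rewrite /has_hyperedge !cat_cons cat0s !has_cat !mem_cat !inE !negb_or /=.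
case/andP=> /andP[/and4P[-> A0 A'0 ->] /forallP cB] hB.
have -> /= : set0 != A :|: A'.
  by rewrite eq_sym setU_eq0 negb_and eq_sym A0.
apply/andP; split.
  apply/forallP => x; move: (cB x); rewrite !count_cat /= inE.
  by case: (x \in A); case: (x \in A') => //=; lia.
have mono (D D' : {set 'I_n}) : D \subset D' ->
    [exists e in E, e \subset D] -> [exists e in E, e \subset D'].
  move=> DD' /existsP[e /andP[eE eD]]; apply/existsP; exists e.
  by rewrite eE (subset_trans eD).
case/or4P: hB => [->|/(mono _ _ (subsetUl _ _)) ->
  |/(mono _ _ (subsetUr _ _)) ->|->] //; by rewrite ?orbT.
Qed.

Lemma admissible_merge_last B :
  1 < size B -> admissible B -> admissible (merge_last B).
Proof.
move=> B1 aB; rewrite merge_rotr //; apply: admissible_merge.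
  by rewrite size_rotr.
by rewrite /rotr admissible_rot.
Qed.

Lemma size_merge i B : i.+1 < size B -> size (merge i B) = (size B).-1.
Proof.
by move=> iB; rewrite size_cat /= size_drop size_takel; lia.
Qed.

Lemma size_merge_last B : 1 < size B -> size (merge_last B) = (size B).-1.
Proof.
by move=> B1; rewrite merge_rotr // size_merge ?size_rotr.
Qed.

Lemma nth_merge i B k : i.+1 < size B -> nth set0 (merge i B) k =
  if k < i then nth set0 B k
  else if k == i then nth set0 B i :|: nth set0 B i.+1 else nth set0 B k.+1.
Proof.
move=> iB; have si : size (take i B) = i by rewrite size_takel //; lia.
rewrite nth_cat si; case: ltnP => ik; first by rewrite nth_take.
case: eqP => [->|nik]; first by rewrite subnn.
have -> : k - i = (k - i).-1.+1 by lia.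
by rewrite /= nth_drop; congr nth; lia.
Qed.

Lemma nth_merge_last B k : 1 < size B -> k < (size B).-1 ->
  nth set0 (merge_last B) k =
  if k == 0 then nth set0 B 0 :|: nth set0 B (size B).-1 else nth set0 B k.
Proof.
move=> B1 kB; rewrite /merge_last; case: k kB => [|k] kB /=.
  by rewrite nth0 nth_last; case: B B1 {kB}.
by rewrite nth_behead nth_take.
Qed.

Lemma contains1S (A D : {set 'I_n}) :
  A \subset D -> contains1 A -> contains1 D.
Proof.
move=> AD /existsP[x /andP[xA x0]]; apply/existsP; exists x.
by rewrite x0 (subsetP AD).
Qed.

Lemma contains1_merge i B : i.+1 < size B ->
  contains1 (nth set0 B 0) -> contains1 (nth set0 (merge i B) 0).
Proof.
move=> iB; rewrite nth_merge //; case: i iB => //= iB.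
by apply: contains1S; apply: subsetUl.
Qed.

Lemma contains1_merge_last B : 1 < size B ->
  contains1 (nth set0 B 0) -> contains1 (nth set0 (merge_last B) 0).
Proof.
move=> B1; rewrite nth_merge_last //=; last by lia.
by apply: contains1S; apply: subsetUl.
Qed.

Lemma merge_merge i j B : i < j -> j.+1 < size B ->
  merge i (merge j B) = merge j.-1 (merge i B).
Proof.
move=> ij jB; have iB : i.+1 < size B by lia.
apply: (@eq_from_nth _ set0); first by rewrite !size_merge //; lia.
move=> k; rewrite ![in nth _ (merge i _) _]nth_merge ?size_merge //; try lia.
rewrite ![in nth _ (merge j.-1 _) _]nth_merge ?size_merge //; try lia.
rewrite !nth_merge // => _.
repeat (case: ifP => ?); try lia; try (congr nth; lia);
  try (congr setU; congr nth; lia); rewrite -?setUA //.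
all: congr setU; try congr setU; congr nth; lia.
Qed.

Lemma merge_merge_last i B : i.+2 < size B ->
  merge i (merge_last B) = merge_last (merge i B).
Proof.
move=> iB; have B1 : 1 < size B by lia.
have [iB1 iB2] : i.+1 < (size B).-1 /\ i.+1 < size B by lia.
apply: (@eq_from_nth _ set0).
  by rewrite size_merge ?size_merge_last ?size_merge //; lia.
move=> k; rewrite size_merge ?size_merge_last // => kB.
rewrite nth_merge ?size_merge_last // [RHS]nth_merge_last ?size_merge //; try lia.
have [-> | k0] := posnP k.
  rewrite !nth_merge // !nth_merge_last //; try lia.
  have -> : ((size B).-2 < i) = false by lia.
  have -> : ((size B).-2 == i) = false by lia.
  have -> : (size B).-2.+1 = (size B).-1 by lia.
  by case: i {iB iB1 iB2} => [|i] //=; rewrite setUAC.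
rewrite nth_merge //; case: ltngtP => ki.
- by rewrite nth_merge_last ?gtn_eqF //; lia.
- by rewrite nth_merge_last //; lia.
rewrite !nth_merge_last //; try lia.
by rewrite !gtn_eqF //; lia.
Qed.

Lemma merge_last_last B : 2 < size B ->
  merge_last (merge_last B) = merge_last (merge (size B).-2 B).
Proof.
move=> B2; have B1 : 1 < size B by lia.
have B3 : (size B).-2.+1 < size B by lia.
apply: (@eq_from_nth _ set0).
  by rewrite !size_merge_last ?size_merge //; lia.
move=> k; rewrite !size_merge_last // => [kB|]; last by lia.
rewrite [LHS]nth_merge_last ?size_merge_last //; last by lia.
rewrite [RHS]nth_merge_last ?size_merge //; try lia.
rewrite !nth_merge // ltnn eqxx !nth_merge_last //; try lia.
have -> : 0 < (size B).-2 by lia.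
have -> : ((size B).-2 == 0) = false by lia.
have -> : (k < (size B).-2) = true by lia.
have -> : (size B).-2.+1 = (size B).-1 by lia.
by case: posnP => k0 //; rewrite setUAC setUA.
Qed.

End OrderedPartitions.

Local Open Scope ring_scope.

Section Complex.

Variables (F : fieldType) (n : nat) (E : {set {set 'I_n}}).

Definition chain (p : nat) := {ffun cyclic_partition E p -> F^o}.

(* The class [B_1, ..., B_(p+1)] of an arbitrary admissible ordered           *)
(* partition: it is rotated until 1 lies in its first block, each step        *)
(* costing the sign (-1)^(r+1) = (-1)^p of the signed cyclic relation         *)
(* (see [cyclic_class_rot1]).                                                 *)
Definition cyclic_class (p : nat) (B : seq {set 'I_n}) : chain p :=
  [ffun b => if tval (val b) == rot (pos1 B) B
             then (-1) ^+ (p * pos1 B)%N else 0].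

(* The boundary of the class of a partition into p + 2 blocks, so in degree   *)
(* r = p; the summation index of the paper is i + 1.                          *)
Definition bdry_class (p : nat) (B : seq {set 'I_n}) : chain p :=
  \sum_(i < p.+1) (-1) ^+ i.+2 *: cyclic_class p (merge i B)
  + (-1) ^+ p.+3 *: cyclic_class p (merge_last B).

Definition bdry_fun (p : nat) (c : chain p.+1) : chain p :=
  \sum_b c b *: bdry_class p (tval (val b)).

Fact bdry_fun_is_linear p : linear (@bdry_fun p).
Proof.
move=> a u v; rewrite /bdry_fun scaler_sumr -big_split /=.
by apply: eq_bigr => b _; rewrite !ffunE scalerDl scalerA.
Qed.

HB.instance Definition _ p :=
  GRing.isLinear.Build F (chain p.+1) (chain p) _ (@bdry_fun p)
    (@bdry_fun_is_linear p).

Definition bdry (p : nat) : 'Hom(chain p.+1, chain p) := linfun (@bdry_fun p).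

(* In degree -1 every chain is a cycle. *)
Definition cycles (p : nat) : {vspace chain p} :=
  match p with
  | 0 => fullv
  | q.+1 => lker (bdry q)
  end.

Definition boundaries (p : nat) : {vspace chain p} := limg (bdry p).

(* The dimension of HC_r, which is cycles modulo boundaries in degree r (see  *)
(* [boundaries_sub_cycles] for the inclusion).                                *)
Definition dimHC (r : int) : nat :=
  match (r + 1)%R with
  | Posz p => \dim (cycles p) - \dim (boundaries p)
  | Negz _ => 0
  end.

Lemma cyclic_class_rot1 p B : size B = p.+1 -> admissible E B ->
  cyclic_class p (rot 1 B) = (-1) ^+ p *: cyclic_class p B.
Proof.
case: B => // A B [sB] aB; apply/ffunP => b; rewrite !ffunE rot1_cons.
have hasB : has (@contains1 n) (A :: B).
  case: (set_0Vmem A) => [A0|[x _]].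
    by move: aB; rewrite /admissible ordered_partitionE A0 inE eqxx.
  have n0 : (0 < n)%N := leq_ltn_trans (leq0n x) (ltn_ord x).
  move: aB; rewrite /admissible ordered_partitionE.
  case/andP=> /andP[_ /forallP /(_ (Ordinal n0)) cB] _.
  have : has (fun A : {set 'I_n} => Ordinal n0 \in A) (A :: B).
    by rewrite has_count (eqP cB).
  by apply: sub_has => D D0; apply/existsP; exists (Ordinal n0); rewrite D0 /=.
rewrite /pos1 -cats1 find_cat /=; case: (boolP (contains1 A)) => [A1|nA1].
  have nB1 : has (@contains1 n) B = false.
    apply/hasP => -[D DB D1].
    case/existsP: A1 => x /andP[xA /eqP x0].
    case/existsP: D1 => y /andP[yD /eqP y0].
    have xy : x = y by apply: val_inj; rewrite x0 y0.
    move: aB; rewrite /admissible ordered_partitionE.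
    case/andP=> /andP[_ /forallP /(_ x)]; rewrite /= xA => cB _.
    have : (0 < count (fun A : {set 'I_n} => x \in A) B)%N.
      by rewrite -has_count; apply/hasP; exists D; rewrite // xy.
    by move: cB; case: count.
  rewrite nB1 addn0 sB rot0 muln0.
  have -> : rot p (B ++ [:: A]) = A :: B by rewrite -sB rot_size_cat.
  case: eqP => _; rewrite ?scaler0 // /GRing.scale /= mulr1.
  by rewrite -signr_odd oddM andbb signr_odd.
have hB : has (@contains1 n) B by move: hasB; rewrite /= (negPf nA1).
rewrite hB.
have -> : rot (find (@contains1 n) B).+1 (A :: B)
        = rot (find (@contains1 n) B) (B ++ [:: A]).
  by rewrite cats1 -rot1_cons -rotD ?addn1 // ltnS find_size.
case: eqP => _; rewrite ?scaler0 // /GRing.scale /= -exprD mulnS addnA.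
by rewrite -[RHS]signr_odd oddD addnn odd_double signr_odd.
Qed.

Let face (p i : nat) (B : seq {set 'I_n}) : seq {set 'I_n} :=
  if (i < p.+1)%N then merge i B else merge_last B.

Let faceP p i (B : seq {set 'I_n}) : size B = p.+2 -> admissible E B ->
    contains1 (nth set0 B 0) ->
  [/\ size (face p i B) = p.+1, admissible E (face p i B)
    & contains1 (nth set0 (face p i B) 0)].
Proof.
move=> sB aB B1; have s1 : (1 < size B)%N by rewrite sB.
rewrite /face; case: ltnP => ip; last first.
  by split; rewrite ?size_merge_last ?sB //;
    [apply: admissible_merge_last|apply: contains1_merge_last].
have s2 : (i.+1 < size B)%N by rewrite sB.
by split; rewrite ?size_merge ?sB //;
  [apply: admissible_merge|apply: contains1_merge].
Qed.

Let face_face p i j (B : seq {set 'I_n}) : size B = p.+3 ->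
  (i <= j)%N -> (j < p.+2)%N ->
  face p i (face p.+1 j.+1 B) = face p j (face p.+1 i B).
Proof.
move=> sB ij jp; rewrite /face.
have -> : (i < p.+2)%N by lia.
case: (ltnP j.+1 p.+2) => jp1.
  have -> : (i < p.+1)%N by lia.
  have -> : (j < p.+1)%N by lia.
  by rewrite merge_merge //; rewrite sB.
have ej : j = p.+1 by lia.
rewrite ej ltnn; case: ltnP => ip; first by rewrite merge_merge_last ?sB.
by rewrite merge_last_last ?sB //; congr merge_last; congr merge; lia.
Qed.

Let bdry_classE p B :
  bdry_class p B = \sum_(0 <= i < p.+2) (-1) ^+ i *: cyclic_class p (face p i B).
Proof.
rewrite big_nat_recr //= big_mkord /bdry_class /face ltnn.
have sgn k : (-1) ^+ k.+2 = (-1) ^+ k :> F by rewrite 2!exprS !mulN1r opprK.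
by rewrite sgn; congr (_ + _); apply: eq_bigr => i _; rewrite sgn ltn_ord.
Qed.

Let bdry_cyclic_class p B : size B = p.+2 -> admissible E B ->
  contains1 (nth set0 B 0) ->
  bdry p (cyclic_class p.+1 B) = bdry_class p B.
Proof.
move=> sB aB B1; rewrite lfunE /= /bdry_fun.
have sBt : size B == p.+2 by apply/eqP.
have ok : admissible E (Tuple sBt) && contains1 (thead (Tuple sBt)).
  by rewrite aB /thead (tnth_nth set0).
pose b : cyclic_partition E p.+1 := Sub (Tuple sBt) ok.
have p0 : pos1 B = 0%N by case: {+}B sB B1 => //= A t _ ->.
rewrite (bigD1 b) //= big1 => [|c nc].
  by rewrite ffunE /= p0 rot0 eqxx muln0 expr0 scale1r addr0.
rewrite ffunE p0 rot0; case: eqP => [e|_]; last by rewrite scale0r.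
by case/eqP: nc; apply/val_inj/val_inj.
Qed.

Lemma bdry_bdry p (c : chain p.+2) : bdry p (bdry p.+1 c) = 0.
Proof.
rewrite [bdry p.+1 c]lfunE /= /bdry_fun linear_sum big1 // => b _.
rewrite linearZ /=; apply/eqP; rewrite scaler_eq0; apply/orP; right; apply/eqP.
have sB : size (tval (val b)) = p.+3 by rewrite size_tuple.
have /andP[aB B1] := valP b; rewrite /thead (tnth_nth set0) /= in B1.
move: (tval (val b)) sB aB B1 => {b c} B sB aB B1.
rewrite bdry_classE linear_sum /=.
under eq_bigr => j _.
  have [sf af f1] := faceP j sB aB B1.
  rewrite linearZ /= bdry_cyclic_class // bdry_classE scaler_sumr.
  under eq_bigr => i _ do rewrite scalerA -exprD.
  over.
pose a i j : chain p := (-1) ^+ (j + i) *: cyclic_class p (face p i (face p.+1 j B)).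
have aS i j : (i <= j < p.+2)%N -> a i j.+1 = - a j i.
  case/andP=> ij jp; rewrite /a (face_face sB ij jp) -scaleNr.
  by rewrite addSn exprS mulN1r addnC.
rewrite -/(a _ _).
transitivity (\sum_(0 <= j < p.+3) \sum_(0 <= i < p.+2) a i j); first by [].
transitivity (\sum_(0 <= j < p.+3) \sum_(0 <= i < p.+2 | (i < j)%N) a i j +
   \sum_(0 <= j < p.+3) \sum_(0 <= i < p.+2 | (j <= i)%N) a i j).
  rewrite -big_split /=; apply: eq_bigr => j _.
  rewrite (bigID (fun i => (i < j)%N)) /=; congr (_ + _).
  by apply: eq_bigl => i; rewrite -leqNgt.
rewrite big_nat_recl // [X in X + _ + _]big_pred0 ?add0r //.
rewrite [X in _ + X]big_nat_recr //= [X in _ + (_ + X)]big_nat_cond.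
rewrite [X in _ + (_ + X)]big_pred0 ?addr0; last by move=> i; lia.
rewrite [X in _ + X](exchange_big_dep predT) //=.
apply/eqP; rewrite addr_eq0 -sumrN; apply/eqP.
rewrite big_nat [RHS]big_nat; apply: eq_bigr => j /= jp.
rewrite -sumrN big_nat_cond [RHS]big_nat_cond; apply: eq_big => [i|i].
  by rewrite ltnS.
by move=> ij; rewrite aS //; lia.
Qed.

Lemma boundaries_sub_cycles p : (boundaries p <= cycles p)%VS.
Proof.
case: p => [|p]; first exact: subvf.
apply/subvP => _ /memv_imgP[c _ ->].
by rewrite memv_ker; apply/eqP/bdry_bdry.
Qed.

End Complex.

(* Main.v *)
(* A partition with a block of size at least n - 2 has at most three blocks,  *)
(* so the complex lives in degrees -1, 0, 1. Write w S for the class          *)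
(* [~: S, S]; the cyclic relation gives w (~: S) = - w S, hence the boundary  *)
(* vanishes in degree 0, and in degree 1                                      *)
(*   bdry [X, Y, Z] = w X + w Y + w Z.                                        *)
(* This depends only on the pair of vertices outside the block of size n - 2. *)
(* The n(n-1) basis elements of degree 1 thus have 'C(n, 2) distinct images,  *)
(* which are independent because the T-th one is the only one involving the   *)
(* basis element +- w T. The three dimensions are therefore 1,                *)
(* n + 'C(n, 2) - 'C(n, 2) and n(n-1) - 'C(n, 2).                             *)

Require Import Defs.
From mathcomp Require Import all_boot all_order all_algebra.
From mathcomp Require Import zify.

Set Implicit Arguments.
Unset Strict Implicit.
Unset Printing Implicit Defensive.

Import GRing.Theory.

(** Rank-nullity gives the dimensions once the basis classes are counted and the ranks of the
    boundary maps are known. A class is determined by what lies outside its large block: nothing for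
    one block, a set of one or two vertices for two blocks ([cyclic_partition1P]), an ordered pair
    of distinct vertices for three ([cyclic_partition2P]); four blocks are impossible. As [5 <= n],
    a set of at most two vertices never has a complement that small, so these parametrizations are
    injective. Only the boundary from three blocks to two has nonzero rank. By [bdry_class3] it is
    cyclically symmetric, so both orderings of a pair [T] map to [pair_boundary T]; these vectors
    are independent ([pair_boundary_free]), so the rank is ['C(n, 2)]. *)

Section Combinatorics.

Variable n : nat.
Implicit Types (A X Y Z S T : {set 'I_n}) (B : seq {set 'I_n}) (o x : 'I_n).

(** * Admissibility in terms of block sizes *)

Lemma contains1E o A : val o = 0 -> contains1 A = (o \in A).
Proof.
move=> o0; apply/existsP/idP => [[x /andP[xA /eqP x0]]|oA]; last first.
  by exists o; rewrite oA o0 /=.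
by rewrite (_ : o = x) //; apply: val_inj; rewrite o0 x0.
Qed.

Lemma exists_complete_uniform_subset k A :
  [exists e in complete_uniform n k, e \subset A] = (k <= #|A|).
Proof.
apply/existsP/card_geqP => [[e /andP[]]|[s [us ss sA]]].
  rewrite inE => /eqP <- /subsetP eA; exists (enum e).
  by rewrite enum_uniq -cardE; split=> // x; rewrite mem_enum => /eA.
exists [set x in s]; rewrite inE cardsE (card_uniqP us) ss eqxx /=.
by apply/subsetP => x; rewrite inE => /sA.
Qed.

Lemma admissibleE k B : admissible (complete_uniform n k) B =
  [&& set0 \notin B, [forall x, count (fun A => x \in A) B == 1]
    & has (fun A => k <= #|A|) B].
Proof.
rewrite /admissible ordered_partitionE -andbA; congr [&& _, _ & _].
by apply: eq_has => A; apply: exists_complete_uniform_subset.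
Qed.

(** Double counting of the pairs (vertex, block containing it). Together with one block of size at
    least [n - 2], this bounds the number and the sizes of the other blocks. *)
Lemma sum_card_blocks B :
  [forall x, count (fun A => x \in A) B == 1] -> \sum_(A <- B) #|A| = n.
Proof.
move=> /forallP cB.
rewrite (eq_bigr (fun A => \sum_(x : 'I_n) (x \in A))); last first.
  move=> A _; rewrite -sum1_card [LHS]big_mkcond.
  by apply: eq_bigr => x _; case: ifP.
rewrite exchange_big /= (eq_bigr (fun=> 1)); first by rewrite sum1_card card_ord.
move=> x _; rewrite -[RHS](eqP (cB x)) -sum1_count [RHS]big_mkcond.
by apply: eq_bigr => A _; case: ifP.
Qed.

Lemma admissible2E k X Y : admissible (complete_uniform n k) [:: X; Y] =
  [&& Y == ~: X, X != set0, Y != set0 & (k <= #|X|) || (k <= #|Y|)].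
Proof.
rewrite admissibleE /= !inE !negb_or orbF ![set0 == _]eq_sym.
have -> : [forall x, (x \in X) + ((x \in Y) + 0) == 1] = (Y == ~: X).
  apply/forallP/eqP => [c|-> x]; last by rewrite inE; case: (x \in X).
  by apply/setP => x; rewrite inE; move: (c x); case: (x \in X); case: (x \in Y).
by rewrite andbCA !andbA.
Qed.

Lemma admissible3E k X Y Z : admissible (complete_uniform n k) [:: X; Y; Z] =
  [&& [forall x, (x \in X) + (x \in Y) + (x \in Z) == 1],
    X != set0, Y != set0, Z != set0
    & [|| k <= #|X|, k <= #|Y| | k <= #|Z|]].
Proof.
rewrite admissibleE /= !inE !negb_or orbF ![set0 == _]eq_sym.
rewrite andbCA -!andbA; congr andb; apply: eq_forallb => x.
by rewrite addn0 addnA.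
Qed.

(** * Normal forms of classes with two and three blocks *)

(** With [o] the distinguished vertex, this is the basis representative of the cut between [S] and
    its complement, whichever side is named. *)
Definition two_blocks o S : 2.-tuple {set 'I_n} :=
  if o \in S then [tuple S; ~: S] else [tuple ~: S; S].

Lemma two_blocksC o S : two_blocks o (~: S) = two_blocks o S.
Proof. by rewrite /two_blocks inE; case: (o \in S); rewrite /= ?setCK. Qed.

Lemma two_blocks_inj o S T :
  two_blocks o S = two_blocks o T -> S = T \/ S = ~: T.
Proof.
rewrite /two_blocks; case: ifP; case: ifP => _ _ /(congr1 val) [] H1 H2; subst;
  rewrite ?setCK; by [left|right].
Qed.

(* The rotation of (~: {a, b}, {a}, {b}), for u = (a, b), whose first block   *)
(* contains o.                                                                *)
Definition three_blocks o (u : 'I_n * 'I_n) : 3.-tuple {set 'I_n} :=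
  let X := ~: [set u.1; u.2] in
  if o == u.1 then [tuple [set u.1]; [set u.2]; X]
  else if o == u.2 then [tuple [set u.2]; X; [set u.1]]
  else [tuple X; [set u.1]; [set u.2]].

Lemma card_setC2 x y : x != y -> #|~: [set x; y]| = n - 2.
Proof. by move=> xy; rewrite cardsCs setCK card_ord cards2 xy. Qed.

(** The block of size [n - 2] cannot be mistaken for a singleton, so its position is determined, and
    the singletons then give [u.1] and [u.2] in cyclic order. *)
Lemma three_blocks_inj o : 5 <= n ->
  {in [pred u | u.1 != u.2] &, injective (three_blocks o)}.
Proof.
move=> n5 [a b] [c d]; rewrite !inE /= => ab cd.
have neq x y z : x != y -> [set z] <> ~: [set x; y].
  by move=> xy /(congr1 (fun A => #|A|)); rewrite card_setC2 // cards1; lia.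
have neq' x y z : x != y -> ~: [set x; y] <> [set z].
  by move=> xy /esym; apply: neq.
rewrite /three_blocks /=.
repeat case: ifP => _; move/(congr1 val) => [] H1 H2 H3.
(* In the six mixed cases the large blocks sit at different positions, so one of them would equal a
   singleton. *)
all: try by [case: (neq _ _ _ cd H1)|case: (neq _ _ _ cd H2)|
  case: (neq _ _ _ cd H3)|case: (neq' _ _ _ ab H1)|
  case: (neq' _ _ _ ab H2)|case: (neq' _ _ _ ab H3)].
- by rewrite (set1_inj H1) (set1_inj H2).
- by rewrite (set1_inj H1) (set1_inj H3).
- by rewrite (set1_inj H2) (set1_inj H3).
Qed.

(** * Classification and count of the basis classes *)

Lemma card_cyclic_partition (E : {set {set 'I_n}}) p :
  #|{: cyclic_partition E p}| =
  #|[set B : p.+1.-tuple {set 'I_n} | admissible E B && contains1 (thead B)]|.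
Proof. by rewrite card_sig cardsE. Qed.

Lemma card_cyclic_partition0 (E : {set {set 'I_n}}) : 0 < n ->
  [exists e in E, e \subset [set: 'I_n]] -> #|{: cyclic_partition E 0}| = 1.
Proof.
move=> n0 hE; pose o := Ordinal n0.
rewrite card_cyclic_partition; apply/eqP/cards1P; exists [tuple [set: 'I_n]].
apply/setP => B; rewrite !inE; apply/andP/eqP => [[aB _]|->].
  case/tupleP: B aB => X B; rewrite tuple0 /= /admissible ordered_partitionE.
  case/andP=> /andP[_ /forallP cX] _; apply: val_inj => /=; congr cons.
  by apply/setP => x; move: (cX x); rewrite inE /=; case: (x \in X).
rewrite theadE (contains1E _ (erefl : val o = 0)) inE; split=> //.
rewrite /admissible ordered_partitionE /= inE orbF hE andbT; apply/andP; split.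
  by apply/eqP => /setP/(_ o); rewrite !inE.
by apply/forallP => x; rewrite inE.
Qed.

Lemma cyclic_partition1P o (B : 2.-tuple {set 'I_n}) : val o = 0 -> 5 <= n ->
  reflect (exists2 S : {set 'I_n}, 0 < #|S| <= 2 & B = two_blocks o S)
    (admissible (complete_uniform n (n - 2)) B && contains1 (thead B)).
Proof.
move=> o0 n5; apply: (iffP andP) => [[aB]|[S Sc ->]].
  case/tupleP: B aB => X B; case/tupleP: B => Y B; rewrite tuple0 theadE /=.
  rewrite admissible2E (contains1E _ o0) => /and4P[/eqP YE X0 Y0 c] oX.
  have cY : #|Y| = n - #|X| by rewrite YE cardsCs setCK card_ord.
  have cX : #|X| <= n by rewrite -[n in _ <= n]card_ord max_card.
  (* The witness is the block opposite the large one. *)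
  rewrite -!card_gt0 in X0 Y0; case/orP: c => c.
    exists Y; first by rewrite cY in Y0 *; lia.
    have /negPf oY : o \notin Y by rewrite YE inE oX.
    by rewrite /two_blocks oY; apply: val_inj; rewrite /= YE setCK.
  exists X; first by rewrite cY in c; move: #|X| cX X0 c => k; lia.
  by rewrite /two_blocks oX; apply: val_inj; rewrite /= YE.
have cS : #|~: S| = n - #|S| by rewrite cardsCs setCK card_ord.
rewrite /two_blocks; case: ifP => oS; rewrite theadE (contains1E _ o0) ?inE ?oS.
  by rewrite /= admissible2E eqxx -!card_gt0 cS; move: #|S| Sc => k; lia.
by rewrite /= admissible2E setCK eqxx -!card_gt0 cS; move: #|S| Sc => k; lia.
Qed.

Lemma card_cyclic_partition1 : 5 <= n ->
  #|{: cyclic_partition (complete_uniform n (n - 2)) 1}| = n + 'C(n, 2).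
Proof.
move=> n5; have n0 : 0 < n by lia.
pose o := Ordinal n0; have o0 : val o = 0 by [].
rewrite card_cyclic_partition.
transitivity #|two_blocks o @: [set S : {set 'I_n} | 0 < #|S| <= 2]|.
  congr #|pred_of_set _|; apply/setP => B; rewrite inE.
  apply/(cyclic_partition1P _ o0 n5)/imsetP => -[S Sc ->]; exists S => //.
    by rewrite inE.
  by move: Sc; rewrite inE.
rewrite card_in_imset => [|S T]; last first.
  (* Complementary sets of size at most 2 would force [n <= 4]. *)
  rewrite !inE => Sc Tc /two_blocks_inj[//|ST]; exfalso.
  by move: Sc; rewrite ST cardsCs setCK card_ord; lia.
have -> : [set S : {set 'I_n} | 0 < #|S| <= 2] =
    [set S : {set 'I_n} | #|S| == 1] :|: [set S : {set 'I_n} | #|S| == 2].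
  by apply/setP => S; rewrite !inE; lia.
rewrite cardsU (_ : _ :&: _ = set0) ?cards0 ?subn0.
  by rewrite !card_draws card_ord bin1.
by apply/setP => S; rewrite !inE; lia.
Qed.

Lemma cyclic_partition2P o (B : 3.-tuple {set 'I_n}) : val o = 0 -> 5 <= n ->
  reflect (exists2 u : 'I_n * 'I_n, u.1 != u.2 & B = three_blocks o u)
    (admissible (complete_uniform n (n - 2)) B && contains1 (thead B)).
Proof.
move=> o0 n5; apply: (iffP andP) => [[aB]|[[a b] /= ab ->]].
  have sB : \sum_(A <- B) #|A| = n.
    by apply: sum_card_blocks; move: aB; rewrite admissibleE => /and3P[].
  have one (x y z : nat) : 0 < y -> 0 < z -> n - 2 <= x -> x + (y + z) = n ->
    (y == 1) && (z == 1) by lia.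
  case/tupleP: B aB sB => X B; case/tupleP: B => Y B; case/tupleP: B => Z B.
  rewrite tuple0 theadE /= !big_cons big_nil admissible3E (contains1E _ o0).
  case/and5P => /forallP c; rewrite -!card_gt0 => X0 Y0 Z0 bg.
  rewrite addn0 => sc oX.
  (* According to the position of the large block; read cyclically from there, the next two blocks
     are the singletons of [a] and [b]. *)
  case/or3P: bg => bg.
  - have /andP[/cards1P[a Ya] /cards1P[b Zb]] := one _ _ _ Y0 Z0 bg sc.
    subst Y Z; exists (a, b); rewrite /=.
      by apply/eqP => ab; move: (c a); rewrite !inE ab eqxx; lia.
    have oa := c o; rewrite oX !inE in oa.
    rewrite /three_blocks /=; have [e|_] := eqVneq o a.
      by move: oa; rewrite e eqxx.
    have [e|_] := eqVneq o b; first by move: oa; rewrite e eqxx; lia.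
    apply: val_inj => /=; congr [:: _; _; _].
    apply/setP => x; move: (c x); rewrite !inE.
    by case: (x \in X); case: (x == a); case: (x == b).
  - rewrite addnCA in sc.
    have /andP[/cards1P[b Xb] /cards1P[a Za]] := one _ _ _ X0 Z0 bg sc.
    subst X Z; exists (a, b); rewrite /=.
      by apply/eqP => ab; move: (c a); rewrite !inE ab eqxx; lia.
    move: (c o) (oX); rewrite !inE => oa /eqP ob.
    rewrite /three_blocks /=; have [e|_] := eqVneq o a.
      by move: oa; rewrite -e ob eqxx; lia.
    rewrite ob (eqxx b).
    apply: val_inj => /=; congr [:: _; _; _].
    apply/setP => x; move: (c x); rewrite !inE.
    by case: (x \in Y); case: (x == a); case: (x == b).
  rewrite addnA addnC in sc.
  have /andP[/cards1P[a Xa] /cards1P[b Yb]] := one _ _ _ X0 Y0 bg sc.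
  subst X Y; exists (a, b); rewrite /=.
    by apply/eqP => ab; move: (c a); rewrite !inE ab eqxx; lia.
  move: oX; rewrite !inE => /eqP oa.
  rewrite /three_blocks /= oa (eqxx a).
  apply: val_inj => /=; congr [:: _; _; _].
  apply/setP => x; move: (c x); rewrite !inE.
  by case: (x \in Z); case: (x == a); case: (x == b).
(* Admissibility is invariant under rotation, so it is checked only with the large block in
   front. *)
have adm : admissible (complete_uniform n (n - 2))
    [:: ~: [set a; b]; [set a]; [set b]].
  rewrite admissible3E -!card_gt0 !cards1 card_setC2 // leqnn.
  apply/and5P; split=> //; try by lia.
  apply/forallP => x; rewrite !inE.
  by have [->|_] := eqVneq x a; [rewrite (negPf ab)|case: (x == b)].
rewrite /three_blocks /=; have [oa|oa] := eqVneq o a.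
  rewrite /thead (tnth_nth set0) /= (contains1E _ o0) !inE oa eqxx.
  by rewrite -(admissible_rot _ 2).
have [ob|ob] := eqVneq o b;
  rewrite /thead (tnth_nth set0) /= (contains1E _ o0) !inE.
  by rewrite ob eqxx -(admissible_rot _ 1).
by rewrite negb_or oa ob.
Qed.

Lemma card_cyclic_partition2 : 5 <= n ->
  #|{: cyclic_partition (complete_uniform n (n - 2)) 2}| = 'C(n, 2).*2.
Proof.
move=> n5; have n0 : 0 < n by lia.
pose o := Ordinal n0; have o0 : val o = 0 by [].
rewrite card_cyclic_partition.
transitivity #|three_blocks o @: [pred u : 'I_n * 'I_n | u.1 != u.2]|.
  apply: eq_card => B; rewrite inE.
  apply/(cyclic_partition2P _ o0 n5)/imsetP => -[u uc ->]; exists u => //.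
rewrite card_in_imset; last exact: three_blocks_inj.
rewrite -sum1_card -(pair_big_dep predT (fun x y => x != y) (fun _ _ => 1)) /=.
rewrite (eq_bigr (fun=> n.-1)).
  by rewrite sum_nat_const card_ord; have := mul_bin_diag n 1; rewrite bin1; lia.
move=> x _; rewrite sum1_card (eq_card (B := predC1 x)) ?cardC1 ?card_ord //.
by move=> y; rewrite !inE eq_sym.
Qed.

(** Three further nonempty blocks beside one of size at least [n - 2] would contain too many
    vertices. *)
Lemma card_cyclic_partition3 : 5 <= n ->
  #|{: cyclic_partition (complete_uniform n (n - 2)) 3}| = 0.
Proof.
move=> n5; rewrite card_cyclic_partition; apply/eqP; rewrite cards_eq0.
apply/eqP/setP => B; rewrite !inE; apply/negbTE/negP => /andP[aB _].
have sB : \sum_(A <- B) #|A| = n.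
  by apply: sum_card_blocks; move: aB; rewrite admissibleE => /and3P[].
move: aB sB; rewrite admissibleE.
case/tupleP: B => X B; case/tupleP: B => Y B; case/tupleP: B => Z B.
case/tupleP: B => T B; rewrite tuple0 /= !big_cons big_nil !inE !negb_or.
rewrite ![set0 == _]eq_sym -!card_gt0.
by move: #|X| #|Y| #|Z| #|T| => x y z t; lia.
Qed.

End Combinatorics.

Local Open Scope ring_scope.

(** * Ranks of the boundary maps *)

Section Homology.

Variables (F : fieldType) (n : nat).
Implicit Types (S T X Y Z : {set 'I_n}) (o x : 'I_n).

Lemma dim_chain (E : {set {set 'I_n}}) p :
  \dim {: chain F E p} = #|{: cyclic_partition E p}|.
Proof. by rewrite dimvf; exact: muln1. Qed.

Lemma bdry_delta (E : {set {set 'I_n}}) p (b : cyclic_partition E p.+1) :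
  bdry F E p [ffun c => (c == b)%:R] = bdry_class F E p (tval (val b)).
Proof.
rewrite lfunE /= /bdry_fun (bigD1 b) //= ffunE eqxx scale1r big1 ?addr0 //.
by move=> c /negPf ncb; rewrite ffunE ncb scale0r.
Qed.

(** Both ways of merging two blocks give the whole vertex set, with opposite signs. *)
Lemma bdry0_eq0 (E : {set {set 'I_n}}) c : bdry F E 0 c = 0.
Proof.
rewrite lfunE /= /bdry_fun big1 // => b _.
apply/eqP; rewrite scaler_eq0; apply/orP; right; apply/eqP.
move: (val b) => B; case/tupleP: B => X B; case/tupleP: B => Y B.
rewrite tuple0 /= /bdry_class big_ord1 /Defs.merge /merge_last /=.
by rewrite !exprS expr0 !mulN1r !opprK scale1r scaleN1r subrr.
Qed.

Lemma dim_cycles (E : {set {set 'I_n}}) p :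
  (\dim (cycles F E p.+1) + \dim (boundaries F E p))%N =
  #|{: cyclic_partition E p.+1}|.
Proof. by rewrite -dim_chain -(limg_ker_dim (bdry F E p) fullv) capfv. Qed.

Lemma dim_boundaries0 (E : {set {set 'I_n}}) : \dim (boundaries F E 0) = 0%N.
Proof.
apply/eqP; rewrite dimv_eq0 -subv0; apply/subvP => _ /memv_imgP[c _ ->].
by rewrite bdry0_eq0 mem0v.
Qed.

Lemma dim_boundaries_eq0 (E : {set {set 'I_n}}) p :
  #|{: cyclic_partition E p.+1}| = 0%N -> \dim (boundaries F E p) = 0%N.
Proof.
move=> h; apply/eqP; rewrite -leqn0 -h -dim_chain.
by rewrite -(limg_ker_dim (bdry F E p) fullv) leq_addl.
Qed.

Variable n5 : (5 <= n)%N.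
Let E := complete_uniform n (n - 2).

Definition cut_class S : chain F E 1 := cyclic_class F E 1 [:: ~: S; S].

Lemma cut_classC S : admissible E [:: ~: S; S] ->
  cut_class (~: S) = - cut_class S.
Proof.
move=> aS; rewrite /cut_class setCK.
rewrite -[[:: S; ~: S]]/(rot 1 [:: ~: S; S]).
by rewrite cyclic_class_rot1 // expr1 scaleN1r.
Qed.

(** A cut class is a basis vector up to sign; recording only which coordinate is nonzero avoids
    tracking that sign. *)
Lemma cut_class_coord o S (b : cyclic_partition E 1) : val o = 0%N ->
  (cut_class S b != 0) = (val b == two_blocks o S).
Proof.
move=> o0; rewrite ffunE mul1n.
have -> : rot (pos1 [:: ~: S; S]) [:: ~: S; S] = two_blocks o S.
  rewrite /pos1 /= !(contains1E _ o0) inE /two_blocks.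
  by case: (o \in S).
rewrite -[RHS]/(tval (val b) == tval (two_blocks o S)).
by case: ifP => _; rewrite ?signr_eq0 ?eqxx.
Qed.

Lemma bdry_class3 X Y Z : admissible E [:: X; Y; Z] ->
  bdry_class F E 1 [:: X; Y; Z] = cut_class X + cut_class Y + cut_class Z.
Proof.
move=> aB; have aM : admissible E [:: X; Y :|: Z].
  exact: (@admissible_merge _ _ 1 [:: X; Y; Z]).
have : [&& Z == ~: (X :|: Y), Y :|: Z == ~: X & Y == ~: (X :|: Z)].
  move: aB; rewrite admissible3E => /andP[/forallP c _].
  by apply/and3P; split; apply/eqP/setP => x; move: (c x); rewrite !inE;
    case: (x \in X); case: (x \in Y); case: (x \in Z).
case/and3P => /eqP ZE /eqP XE /eqP YE; rewrite XE in aM.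
rewrite /bdry_class big_ord_recl big_ord1 /Defs.merge /merge_last /= XE.
have -> : [:: X :|: Y; Z] = [:: ~: Z; Z] by rewrite ZE setCK.
have -> : [:: X :|: Z; Y] = [:: ~: Y; Y] by rewrite YE setCK.
(* Merging [Y] and [Z] contributes [- cut_class (~: X)], which antisymmetry turns into
   [cut_class X]; the other two merges already have the right form and sign. *)
have XC : [:: X; ~: X] = [:: ~: ~: X; ~: X] by rewrite setCK.
rewrite XC in aM *; rewrite -!/(cut_class _) -[X in _ = cut_class X + _ + _]setCK.
rewrite [cut_class (~: ~: X)]cut_classC //.
rewrite !exprS expr0 !mulN1r !opprK !scale1r scaleN1r.
by rewrite -addrA addrC.
Qed.

(* For #|T| = 2, the boundary of either class with blocks ~: T, {a}, {b},     *)
(* where T = {a, b}.                                                          *)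
Definition pair_boundary T : chain F E 1 :=
  \sum_(x in T) cut_class [set x] + cut_class (~: T).

Lemma bdry_class_three_blocks o u : val o = 0%N -> u.1 != u.2 ->
  bdry_class F E 1 (three_blocks o u) = pair_boundary [set u.1; u.2].
Proof.
move=> o0 u12; rewrite /pair_boundary big_setU1 ?inE //= big_set1.
have : admissible E (three_blocks o u).
  have : admissible E (three_blocks o u) && contains1 (thead (three_blocks o u)).
    by apply/(cyclic_partition2P _ o0 n5); exists u.
  by case/andP.
rewrite /three_blocks; case: ifP => _; last case: ifP => _;
  move=> /bdry_class3 -> //.
  by rewrite addrAC [X in X + _]addrC.
by rewrite -addrA addrC.
Qed.

(** The cut between a pair and its complement differs from every singleton cut and from the cut of
    any other pair, by size; so only the term [cut_class (~: S)] can contribute, and only when [S]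
    is [T]. *)
Lemma pair_boundary_coord o S T (b : cyclic_partition E 1) : val o = 0%N ->
    #|S| = 2%N -> #|T| = 2%N -> val b = two_blocks o T ->
  (pair_boundary S b != 0) = (S == T).
Proof.
move=> o0 cS cT bT.
have cC : (#|~: T| > 2)%N by rewrite cardsCs setCK card_ord cT; lia.
rewrite ffunE sum_ffunE big1 ?add0r => [|x _]; last first.
  apply/eqP; rewrite -[_ == _]negbK (cut_class_coord _ _ o0) bT.
  apply/eqP => /two_blocks_inj[e|e]; first by move: cT; rewrite e cards1.
  by move: cC; rewrite e setCK cards1.
rewrite (cut_class_coord _ _ o0) bT two_blocksC.
apply/eqP/eqP => [|-> //].
by case/two_blocks_inj => // e; move: cC; rewrite e setCK cS.
Qed.

Let D := [set T : {set 'I_n} | #|T| == 2].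
Let V := [tuple pair_boundary (enum_val i) | i < #|D|].

Lemma pair_boundary_free : free V.
Proof.
have n0 : (0 < n)%N by lia.
pose o := Ordinal n0; have o0 : val o = 0%N by [].
apply/freeP => k.
under eq_bigr do rewrite -tnth_nth tnth_mktuple.
move=> V0 i.
have /eqP cT : #|enum_val i| == 2 by have := enum_valP i; rewrite inE.
have ok : admissible E (two_blocks o (enum_val i))
    && contains1 (thead (two_blocks o (enum_val i))).
  by apply/(cyclic_partition1P _ o0 n5); exists (enum_val i); rewrite ?cT.
pose b : cyclic_partition E 1 := Sub (two_blocks o (enum_val i)) ok.
(* At the coordinate of the [i]-th pair, only the [i]-th term of the vanishing combination
   survives. *)
have /ffunP/(_ b) := V0; rewrite sum_ffunE (bigD1 i) //= big1 => [|j ji].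
  rewrite addr0 [LHS]ffunE [RHS]ffunE => /eqP.
  rewrite mulf_eq0 => /orP[/eqP //|].
  by rewrite -[_ == 0]negbK (pair_boundary_coord o0 cT cT) // eqxx.
have /eqP cS : #|enum_val j| == 2 by have := enum_valP j; rewrite inE.
rewrite ffunE.
apply/eqP; rewrite mulf_eq0 -[X in _ || X]negbK.
rewrite (pair_boundary_coord o0 cS cT) //.
by rewrite (inj_eq enum_val_inj) (negPf ji) orbT.
Qed.

Lemma boundaries1E : boundaries F E 1 = <<V>>%VS.
Proof.
have n0 : (0 < n)%N by lia.
pose o := Ordinal n0; have o0 : val o = 0%N by [].
apply/eqP; rewrite eqEsubv; apply/andP; split.
  apply/subvP => _ /memv_imgP[c _ ->]; rewrite lfunE /= /bdry_fun.
  apply: memv_suml => b _; apply: memvZ; apply: memv_span.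
  have /(cyclic_partition2P _ o0 n5)[u u12 ->] := valP b.
  rewrite (bdry_class_three_blocks o0 u12).
  have uD : [set u.1; u.2] \in D by rewrite inE cards2 u12.
  by apply/mapP; exists (enum_rank_in uD [set u.1; u.2]);
    rewrite ?mem_enum // enum_rankK_in.
apply/span_subvP => _ /mapP[i _ ->].
(* Either ordering of the pair gives a preimage; [(x, y)] is taken. *)
have := enum_valP i; rewrite inE => /cards2P[x [y [xy ->]]].
have ok : admissible E (three_blocks o (x, y))
    && contains1 (thead (three_blocks o (x, y))).
  by apply/(cyclic_partition2P _ o0 n5); exists (x, y).
pose b : cyclic_partition E 2 := Sub (three_blocks o (x, y)) ok.
apply/memv_imgP; exists [ffun c => (c == b)%:R]; first exact: memvf.
by rewrite bdry_delta (@bdry_class_three_blocks o (x, y)).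
Qed.

Lemma dim_boundaries1 : \dim (boundaries F E 1) = 'C(n, 2).
Proof.
rewrite boundaries1E (eqP pair_boundary_free) size_tuple.
by rewrite card_draws card_ord.
Qed.

End Homology.

Theorem theorem3p6 (F : fieldType) (charF : [pchar F] =i pred0)
    (n : nat) (n_ge5 : (5 <= n)%N) (r : int) (r_range : -1 <= r <= 1) :
  dimHC F (complete_uniform n (n - 2)%N) r = 'C(n, `|(r + 1)%R|%N).
Proof.
set E := complete_uniform n (n - 2).
have d1 := dim_boundaries1 F n_ge5.
have c1 := dim_cycles F E 0; have c2 := dim_cycles F E 1.
rewrite dim_boundaries0 card_cyclic_partition1 // addn0 in c1.
rewrite d1 card_cyclic_partition2 // in c2.
have [p p3 ->] : exists2 p : nat, (p < 3)%N & r = p%:Z - 1.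
  by exists `|(r + 1)%R|%N; lia.
rewrite /dimHC subrK; case: p p3 => [|[|[|//]]] _ /=.
- rewrite bin0 dim_boundaries0 subn0 dim_chain.
  rewrite card_cyclic_partition0 //; first by lia.
  by rewrite exists_complete_uniform_subset cardsT card_ord leq_subr.
- by rewrite c1 d1 addnK bin1.
(* In the top degree there are no boundaries, and the cycles have dimension twice ['C(n, 2)] minus
   the rank ['C(n, 2)]. *)
rewrite (dim_boundaries_eq0 _ (card_cyclic_partition3 n_ge5)) subn0.
by move: c2; rewrite -addnn => /addIn.
Qed.
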